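(* Let $M\ge 1$ be an integer and let $q\in(1,M+1]$. The following statements are equivalent: (i) $q\in\mathcal{U}$; (ii) $\dim_H \pi_{M+1}(\mathcal{U}_r'\setminus\mathcal{U}_q')>0$ for every $r\in(q,M+1]$; (iii) $\dim_H\big(\mathcal{U}\cap(q,r)\big)>0$ for every $r\in(q,M+1]$.
   Context: Fix an integer $M\ge1$. For $q>1$ and a sequence $(d_i)\in\{0,1,\ldots,M\}^\infty$ write $\pi_q((d_i))=\sum_{i=1}^\infty d_iq^{-i}$; $(d_i)$ is called a $q$-expansion of $x$ if $x=\pi_q((d_i))$. For $q\in(1,M+1]$, $\mathcal{U}_q'$ denotes the set of sequences $(d_i)\in\{0,\ldots,M\}^\infty$ such that $(d_i)$ is the unique $q$-expansion (with digits in $\{0,\ldots,M\}$) of the number $\pi_q((d_i))$. $\mathcal{U}$ denotes the set of real numbers $q>1$ such that $1$ has a unique $q$-expansion with digits in $\{0,\ldots,M\}$ (so $\mathcal U\subseteq(1,M+1]$). $\dim_H$ denotes Hausdorff dimension in $\mathbb R$ with the Euclidean metric. *)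

(* Defs.v *)
From HB Require Import structures.
From mathcomp Require Import all_boot all_order all_algebra.
From mathcomp Require Import all_classical all_reals all_analysis.

Set Implicit Arguments.
Unset Strict Implicit.
Unset Printing Implicit Defensive.

Import Order.TTheory GRing.Theory Num.Theory.
Import numFieldNormedType.Exports.

Local Open Scope classical_set_scope.
Local Open Scope ring_scope.

Section Hausdorff.
Context {R : realType}.
Implicit Types (A : set R) (s delta : R).
Local Open Scope ereal_scope.

Definition diam A : \bar R :=
  ereal_sup [set (`|x - y|)%R%:E | x in A & y in A].

(* The case split makes the empty set weigh 0 for every s: by convention
   x `^ 0 = 1 even for x = 0, and the diameter of set0 is -oo. *)
Definition hausdorff_weight s A : \bar R :=
  if A == set0 then 0 else poweR (diam A) s.

(* Finite covers are included, since F may be eventually set0. *)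
Definition hausdorff_content s delta A : \bar R :=
  ereal_inf [set \sum_(0 <= i <oo) hausdorff_weight s (F i) |
    F in [set F : (set R)^nat |
      A `<=` \bigcup_i F i /\ forall i, diam (F i) <= delta%:E]].

Definition hausdorff_measure s A : \bar R :=
  ereal_sup [set hausdorff_content s delta A |
    delta in [set delta : R | (0 < delta)%R]].

Definition hausdorff_dim A : \bar R :=
  ereal_inf [set s%:E |
    s in [set s : R | (0 <= s)%R /\ hausdorff_measure s A = 0]].

End Hausdorff.

Section Expansions.
Context {R : realType}.
Variable M : nat.
Implicit Types (q : R) (d : nat -> 'I_M.+1).

(* Digits are indexed from 0: d i is the (i+1)-st digit. *)
Definition expansion_value q d : R :=
  limn (series (fun i => (d i)%:R / q ^+ i.+1)).

Definition is_expansion q (x : R) d : Prop := x = expansion_value q d.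

Definition univoque_seqs q : set (nat -> 'I_M.+1) :=
  [set d | forall e, is_expansion q (expansion_value q d) e -> e = d].

Definition univoque_bases : set R :=
  [set q | 1 < q /\ exists! d, is_expansion q 1 d].

End Expansions.

Arguments univoque_bases {R} M.
Arguments univoque_seqs {R} M q.

(* Main.v *)
(* A sequence d is the unique expansion of its value in base q <= M + 1 iff every
   tail behind a digit below M has value < 1, and likewise for the reflected sequence
   M - d; call this "admissible".

   If q is not in U, then for r slightly above q every sequence in U'_r \ U'_q has a
   tail which, possibly reflected, has value < 1 in base r and >= 1 in base q.
   By compactness such tails exist for r close to q only if 1 has a weakly admissible
   expansion f in base q, and f is unique.  Since q is not in U, f is purely periodic,
   and the tails can only be f itself.  So U'_r \ U'_q is countable, and so is
   U ∩ (q, r), which embeds into it by sending p to 0 followed by the expansion of 1.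

   If q is in U with expansion a of 1, take a long prefix u of a without border, and
   let u+ be u with its last digit raised by 1.  Sequences of blocks u and u+ that are
   reflected after each raised block, starting with u+ followed by two unraised blocks and
   having no two consecutive unraised blocks later on, dominate all their own shifts and all
   reflected ones, so they expand 1 in bases p of U slightly above q.  These
   sequences form a Cantor set on which both p and the value in base M + 1 separate points
   at a geometric rate, which gives positive dimension. *)

Require Import Defs.
From mathcomp Require Import all_boot all_order all_algebra.
From mathcomp Require Import all_classical all_reals all_analysis.
From mathcomp Require Import zify ring lra.

Set Implicit Arguments.
Unset Strict Implicit.
Unset Printing Implicit Defensive.

Import Order.TTheory GRing.Theory Num.Theory.
Import numFieldNormedType.Exports.

Local Open Scope classical_set_scope.
Local Open Scope ring_scope.

Definition tail (T : Type) (n : nat) (d : nat -> T) : nat -> T :=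
  fun i => d (n + i)%N.

Definition bar (M : nat) (d : nat -> 'I_M.+1) : nat -> 'I_M.+1 :=
  fun i => rev_ord (d i).

Arguments tail : simpl never.
Arguments bar : simpl never.

Section Sequences.
Context {T : Type}.
Implicit Types d e : nat -> T.

Lemma tail0 d : tail 0 d = d.
Proof. by []. Qed.

Lemma tail_tail m n d : tail m (tail n d) = tail (n + m) d.
Proof. by apply/funext => i; rewrite /tail addnA. Qed.

Lemma first_difference d e :
  d <> e -> exists k, (forall i, (i < k)%N -> d i = e i) /\ d k <> e k.
Proof.
move=> de; have /existsNP[n dn] : ~ forall n, d n = e n by move=> /funext.
have ex : exists n, `[< d n <> e n >] by exists n; apply/asboolP.
case: (ex_minnP ex) => k /asboolP dk kmin; exists k; split => // i ik.
apply: contrapT => di; have /kmin : `[< d i <> e i >] by apply/asboolP.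
by rewrite leqNgt ik.
Qed.

End Sequences.

Section Bar.
Context {M : nat}.
Implicit Types d : nat -> 'I_M.+1.

Lemma barE d i : bar d i = (M - d i)%N :> nat.
Proof. by rewrite /bar /= subSS. Qed.

Lemma barK : involutive (@bar M).
Proof. by move=> d; apply/funext => i; rewrite /bar rev_ordK. Qed.

Lemma bar_gt0 d i : (0 < bar d i)%N = (d i < M)%N.
Proof. by rewrite barE subn_gt0. Qed.

Lemma bar_ltM d i : (bar d i < M)%N = (0 < d i)%N.
Proof. by rewrite -{2}(barK d) bar_gt0. Qed.

Lemma bar_tail n d : bar (tail n d) = tail n (bar d).
Proof. by []. Qed.

End Bar.

Section Expansion_value.
Context {R : realType} {M : nat}.
Implicit Types (q r : R) (d e : nat -> 'I_M.+1).

Lemma is_cvg_expansion q d : 1 < q ->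
  cvgn (series (fun i => (d i)%:R / q ^+ i.+1 : R)).
Proof.
move=> q1; have q0 : 0 < q by lra.
apply: (@series_le_cvg _ _ (geometric M%:R q^-1)) => [n|n|n|].
- by rewrite divr_ge0// exprn_ge0// ltW.
- by rewrite /= mulr_ge0// exprn_ge0// invr_ge0 ltW.
- rewrite /= exprVn; apply: ler_pM => //; first by rewrite invr_ge0 exprn_ge0// ltW.
    by rewrite ler_nat -ltnS.
  by rewrite lef_pV2 ?posrE ?exprn_gt0// ltW// ltr_eXn2l.
- by apply: is_cvg_geometric_series; rewrite ger0_norm ?invr_ge0 ?ltW// invf_lt1.
Qed.

Lemma expansion_rec q d : 1 < q ->
  expansion_value q d = ((d 0)%:R + expansion_value q (tail 1 d)) / q.
Proof.
move=> q1; have q0 : q != 0 by lra.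
have c := is_cvg_expansion (d := tail 1 d) q1.
apply/cvg_lim => //; rewrite -cvg_shiftS /=.
rewrite (_ : (fun n : nat => series _ n.+1) = fun n => ((d 0)%:R +
    series (fun i => (tail 1 d i)%:R / q ^+ i.+1) n) / q); last first.
  apply/funext => n /=; rewrite !seriesEnat /= big_nat_recl//= expr1 mulrDl.
  congr (_ + _); rewrite mulr_suml; apply: eq_bigr => i _.
  by rewrite /tail add1n [q ^+ i.+2]exprSr invfM mulrA.
by apply: cvgM; [apply: cvgD => //; exact: cvg_cst|exact: cvg_cst].
Qed.

Lemma expansion_mulE q d : 1 < q ->
  q * expansion_value q d = (d 0)%:R + expansion_value q (tail 1 d).
Proof. by move=> q1; rewrite expansion_rec// mulrC divfK//; lra. Qed.

Lemma expansion_ge0 q d : 1 < q -> 0 <= expansion_value q d.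
Proof.
move=> q1; apply: limr_ge; first exact: is_cvg_expansion.
near=> n; apply: sumr_ge0 => i _; rewrite divr_ge0// exprn_ge0//; lra.
Unshelve. all: by end_near. Qed.

Lemma expansion_mono q r d : 1 < q -> q <= r ->
  r * expansion_value r d <= q * expansion_value q d.
Proof.
move=> q1 qr; have r1 : 1 < r by lra.
rewrite !expansion_mulE// lerD2l.
apply: ler_lim; [exact: is_cvg_expansion|exact: is_cvg_expansion|].
near=> n; apply: ler_sum => i _; apply: ler_wpM2l => //.
rewrite lef_pV2 ?posrE ?exprn_gt0//; [|lra|lra].
by apply: lerXn2r; rewrite ?nnegrE//; lra.
Unshelve. all: by end_near. Qed.

Lemma expansion_le q r d : 1 < q -> q <= r ->
  expansion_value r d <= expansion_value q d.
Proof.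
move=> q1 qr; have := expansion_mono d q1 qr; have := expansion_ge0 d q1.
by have := @expansion_ge0 r d; nra.
Qed.

Lemma expansion_bar q d : 1 < q ->
  expansion_value q (bar d) = M%:R / (q - 1) - expansion_value q d.
Proof.
move=> q1; apply/cvg_lim => //.
rewrite (_ : series _ = fun n => series (geometric (M%:R / q) q^-1) n -
    series (fun i => (d i)%:R / q ^+ i.+1) n).
  apply: cvgB; last exact: is_cvg_expansion.
  rewrite (_ : M%:R / (q - 1) = (M%:R / q) * (1 - q^-1)^-1).
    by apply: cvg_geometric_series; rewrite ger0_norm ?invr_ge0 ?invf_lt1; lra.
  by field; lra.
apply/funext => n; rewrite /= !seriesEnat /= -sumrB; apply: eq_bigr => i _.
rewrite subSS natrB -1?ltnS// mulrBl exprSr invfM exprVn.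
by rewrite mulrA mulrAC.
Qed.

Lemma expansion_leM q d : 1 < q -> expansion_value q d <= M%:R / (q - 1).
Proof.
by move=> q1; have := expansion_ge0 (bar d) q1; rewrite expansion_bar//; lra.
Qed.

(* Reflecting the digits turns the monotonicity in the base into an upper bound for the
   variation in the base. *)
Lemma expansion_lipschitz q r d : 1 < q -> q <= r ->
  expansion_value q d - expansion_value r d <= M%:R / (q - 1) ^+ 2 * (r - q).
Proof.
move=> q1 qr; have := expansion_le (bar d) q1 qr.
rewrite !expansion_bar//; last lra.
suff : (M%:R / (q - 1) - M%:R / (r - 1) <= M%:R / (q - 1) ^+ 2 * (r - q)) by lra.
rewrite (_ : _ - _ = M%:R * (r - q) / (q - 1) * (r - 1)^-1); last by field; lra.
rewrite [leRHS](_ : _ = M%:R * (r - q) / (q - 1) * (q - 1)^-1); last by field; lra.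
apply: ler_wpM2l; last by rewrite lef_pV2 ?posrE; lra.
by rewrite divr_ge0 ?mulr_ge0//; lra.
Qed.

Lemma expansion_prefix q d e n : 1 < q -> (forall i, (i < n)%N -> d i = e i) ->
  expansion_value q d - expansion_value q e =
  (expansion_value q (tail n d) - expansion_value q (tail n e)) / q ^+ n.
Proof.
move=> q1; have q0 : q != 0 by lra.
elim: n d e => [|n IH] d e de; first by rewrite expr0 divr1 !tail0.
rewrite expansion_rec// (expansion_rec e)// de// -mulrBl opprD addrACA subrr add0r.
rewrite (IH (tail 1 d) (tail 1 e)); last by move=> i ni; rewrite /tail de ?add1n.
by rewrite !tail_tail add1n exprSr invfM mulrA.
Qed.

Lemma expansion_prefix_le q d e n : 1 < q ->
  (forall i, (i < n)%N -> d i = e i) ->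
  expansion_value q d - expansion_value q e <= M%:R / (q - 1) / q ^+ n.
Proof.
move=> q1 /(expansion_prefix q1)->; apply: ler_wpM2r.
  by rewrite invr_ge0 exprn_ge0//; lra.
by have := expansion_leM (tail n d) q1; have := expansion_ge0 (tail n e) q1; lra.
Qed.

Lemma expansion_first_difference q d e k : 1 < q ->
  (forall i, (i < k)%N -> d i = e i) -> (d k < e k)%N ->
  (1 + expansion_value q (tail k.+1 e) - expansion_value q (tail k.+1 d))
    / q ^+ k.+1 <= expansion_value q e - expansion_value q d.
Proof.
move=> q1 de dek; have q0 : 0 < q by lra.
rewrite (@expansion_prefix _ _ _ k)//; last by move=> i ik; rewrite de.
rewrite (expansion_rec (tail k e))// (expansion_rec (tail k d))// !tail_tail addn1.
rewrite -mulrBl exprS invfM mulrA; apply: ler_wpM2r.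
  by rewrite invr_ge0 exprn_ge0// ltW.
apply: ler_wpM2r; first by rewrite invr_ge0 ltW.
rewrite /tail addn0.
suff : (d k)%:R + 1 <= (e k)%:R :> R by lra.
by rewrite natr1 ler_nat.
Qed.

End Expansion_value.

Lemma ltr_exp_small {R : realType} (a x c : R) : 1 < a -> 0 < c ->
  exists n, x / a ^+ n < c.
Proof.
move=> a1 c0.
have : geometric x a^-1 n @[n --> \oo] --> 0.
  by apply: cvg_geometric; rewrite ger0_norm ?invr_ge0 ?invf_lt1; lra.
move=> /cvgr_lt /(_ c c0) [n _ /(_ n (leqnn n))] /=.
by rewrite exprVn => ?; exists n.
Qed.

Lemma contraction_le0 {R : realType} (I : Type) (D : I -> R) (a B : R) :
  1 < a -> (forall i, D i <= B) ->
  (forall i, 0 < D i -> exists j, D i <= D j / a) -> forall i, D i <= 0.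
Proof.
move=> a1 DB DD i; rewrite leNgt; apply/negP => Di.
have step n : exists j, D i <= D j / a ^+ n.
  elim: n => [|n [j ij]]; first by exists i; rewrite expr0 divr1.
  have Dj : 0 < D j.
    rewrite ltNge; apply/negP => Dj; suff : D j / a ^+ n <= 0 by lra.
    by rewrite mulr_le0_ge0// invr_ge0 exprn_ge0//; lra.
  have [k jk] := DD j Dj; exists k; apply: (le_trans ij).
  rewrite exprS invfM mulrA; apply: ler_wpM2r => //.
  by rewrite invr_ge0 exprn_ge0//; lra.
have [n Bn] := ltr_exp_small B a1 Di; have [j] := step n.
apply/negP; rewrite -ltNge; apply: le_lt_trans Bn; apply: ler_wpM2r => //.
by rewrite invr_ge0 exprn_ge0//; lra.
Qed.

Definition scons (T : Type) (c : T) (f : nat -> T) : nat -> T :=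
  fun i => if i is j.+1 then f j else c.

Definition splice (T : Type) (n : nat) (d f : nat -> T) : nat -> T :=
  fun i => if (i < n)%N then d i else f (i - n)%N.

Section Splice.
Context {T : Type}.
Implicit Types d f : nat -> T.

Lemma tail1_scons c f : tail 1 (scons c f) = f.
Proof. by []. Qed.

Lemma tail_splice n d f : tail n (splice n d f) = f.
Proof. by apply/funext => i; rewrite /tail /splice ltnNge leq_addr addKn. Qed.

Lemma splice_tail n d : splice n d (tail n d) = d.
Proof.
by apply/funext => i; rewrite /splice /tail; case: ltnP => // ?; rewrite subnKC.
Qed.

End Splice.

Section Existence.
Context {R : realType} {M : nat}.
Implicit Types q x : R.

Let digit q x : 'I_M.+1 := inord (minn M (Num.truncn (q * x))).

Let remainder q x n := iter n (fun y => q * y - (digit q y)%:R) x.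

Lemma expansion_exists q x : 1 < q -> q <= M.+1%:R ->
  0 <= x -> x <= M%:R / (q - 1) -> exists d : nat -> 'I_M.+1, x = expansion_value q d.
Proof.
move=> q1 qM x0 xM.
have M1 : 1 <= M%:R / (q - 1).
  by rewrite ler_pdivlMr ?subr_gt0// mul1r; move: qM; rewrite -natr1; lra.
have digitE y : digit q y = minn M (Num.truncn (q * y)) :> nat.
  by rewrite inordK// ltnS geq_minl.
have rem_itv n : 0 <= remainder q x n <= M%:R / (q - 1).
  elim: n => [|n]; first by rewrite x0.
  rewrite /remainder iterS -/(remainder q x n).
  move: (remainder q x n) => y /andP[y0 yM].
  have /truncn_itv/andP[lo hi] : 0 <= q * y by apply: mulr_ge0 => //; lra.
  rewrite digitE; case: (leqP M (Num.truncn (q * y))) => [le|/ltnW le].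
    apply/andP; split.
      by rewrite subr_ge0 (le_trans _ lo)// ler_nat.
    rewrite lerBlDr (_ : _ + _ = q * (M%:R / (q - 1))); last by field; lra.
    by apply: ler_wpM2l => //; lra.
  by rewrite subr_ge0 lo/=; move: hi; rewrite -natr1; lra.
pose d n := digit q (remainder q x n).
pose D n := remainder q x n - expansion_value q (tail n d).
have DS n : D n = D n.+1 / q.
  rewrite /D (expansion_rec (tail n d))// tail_tail addn1.
  by rewrite /remainder iterS -/(remainder q x n) /tail addn0 -/(d n); field; lra.
have DB n : `|D n| <= M%:R / (q - 1).
  have := rem_itv n; have := expansion_leM (tail n d) q1.
  have := expansion_ge0 (tail n d) q1; rewrite ler_norml /D; lra.
have D0 : D 0%N <= 0.
  apply: (@contraction_le0 _ _ D q (M%:R / (q - 1))) => // [n|n _].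
    exact: le_trans (ler_norm _) (DB n).
  by exists n.+1; rewrite DS.
have N0 : - D 0%N <= 0.
  apply: (@contraction_le0 _ _ (fun n => - D n) q (M%:R / (q - 1))) => // [n|n _].
    by apply: le_trans (ler_norm _) _; rewrite normrN.
  by exists n.+1; rewrite DS mulNr.
by exists d; move: D0 N0; rewrite /D tail0 /remainder /=; lra.
Qed.

End Existence.

Section Univoque.
Context {R : realType} {M : nat}.
Implicit Types (q r : R) (d e : nat -> 'I_M.+1).

Definition admissible q d := forall n,
  ((d n < M)%N -> expansion_value q (tail n.+1 d) < 1) /\
  ((0 < d n)%N -> expansion_value q (tail n.+1 (bar d)) < 1).

Lemma admissible_le q r d : 1 < q -> q <= r -> admissible q d -> admissible r d.
Proof.
move=> q1 qr ad n; have [h1 h2] := ad n; split => h.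
  exact: le_lt_trans (expansion_le _ q1 qr) (h1 h).
exact: le_lt_trans (expansion_le _ q1 qr) (h2 h).
Qed.

Lemma admissible_eq q d e : 1 < q -> admissible q d ->
  expansion_value q d = expansion_value q e -> e = d.
Proof.
move=> q1 ad de; apply: contrapT => /first_difference[k [kE]].
have [h1 h2] := ad k.
have qk : 0 < q ^+ k.+1 by rewrite exprn_gt0//; lra.
have aux d' e' : (forall i, (i < k)%N -> d' i = e' i) -> (d' k < e' k)%N ->
    expansion_value q (tail k.+1 d') < 1 ->
    expansion_value q d' = expansion_value q e' -> False.
  move=> de' dk lt1 eqV; have := expansion_first_difference q1 de' dk.
  rewrite eqV subrr; have := expansion_ge0 (tail k.+1 e') q1.
  rewrite pmulr_lle0 ?invr_gt0// => ? ?; lra.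
move/eqP; rewrite -val_eqE neq_ltn => /orP[lt|lt].
  apply: (aux (bar d) (bar e)); last by rewrite !expansion_bar// de.
  - by move=> i ik; rewrite /bar kE.
  - by move: lt (ltn_ord (d k)); rewrite !barE /=; lia.
  - by apply: h2; apply: leq_trans lt.
apply: (aux d e) => // [i ik|]; first by rewrite kE.
exact: h1 (leq_trans lt (leq_ord (e k))).
Qed.

Lemma admissible_univoque q d : 1 < q -> admissible q d -> univoque_seqs M q d.
Proof. by move=> q1 ad e /(admissible_eq q1 ad). Qed.

Lemma univoque_seqs_bar q d : 1 < q ->
  univoque_seqs M q d -> univoque_seqs M q (bar d).
Proof.
move=> q1 ud e; rewrite /is_expansion expansion_bar// => de.
rewrite -(barK e) (ud (bar e))// /is_expansion expansion_bar// -de; lra.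
Qed.

(* If the tail behind a digit below M is worth at least 1, that digit can be raised. *)
Lemma univoque_admissible q d : 1 < q -> q <= M.+1%:R ->
  univoque_seqs M q d -> admissible q d.
Proof.
move=> q1 qM.
have aux d' n : univoque_seqs M q d' -> (d' n < M)%N ->
    expansion_value q (tail n.+1 d') < 1.
  move=> ud dM; rewrite ltNge; apply/negP => ge1.
  have [f Ef] : exists f : nat -> 'I_M.+1,
      expansion_value q (tail n.+1 d') - 1 = expansion_value q f.
    apply: expansion_exists => //; first lra.
    by have := expansion_leM (tail n.+1 d') q1; lra.
  pose e := splice n d' (scons (inord (d' n).+1) f).
  have : e = d'.
    apply: ud; apply/eqP; rewrite -subr_eq0; apply/eqP.
    rewrite (@expansion_prefix _ _ _ _ _ n)//; last by move=> i ni; rewrite /e /splice ni.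
    rewrite /e tail_splice (expansion_rec (tail n d'))// (expansion_rec (scons _ _))//.
    rewrite tail1_scons -Ef tail_tail addn1 /tail addn0 /= inordK//.
    by rewrite -natr1; field; rewrite ?expf_neq0//; lra.
  move=> /(congr1 (fun g => val (g n))).
  by rewrite /e /splice ltnn subnn /= inordK// => /eqP; rewrite eqn_leq ltnn.
move=> ud n; split => [|dn]; first exact: aux.
by apply: aux; [exact: univoque_seqs_bar|rewrite bar_ltM].
Qed.

Lemma admissible_base q d : 1 < q -> expansion_value q d = 1 -> admissible q d ->
  univoque_bases M q.
Proof.
move=> q1 d1 ad; split => //; exists d; split; first by rewrite /is_expansion.
by move=> e; rewrite /is_expansion -d1 => /(admissible_eq q1 ad).
Qed.

Lemma univoque_base_leM q : univoque_bases M q -> q <= M.+1%:R.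
Proof.
move=> [q1 [d [d1 _]]]; have := expansion_leM d q1.
rewrite -d1 ler_pdivlMr ?subr_gt0// -natr1; lra.
Qed.

Lemma univoque_base_expansion q : univoque_bases M q ->
  1 < q /\ exists2 d : nat -> 'I_M.+1, expansion_value q d = 1 & admissible q d.
Proof.
move=> uq; have qM := univoque_base_leM uq; case: uq => q1 [d [d1 du]].
split => //; exists d; first by rewrite -d1.
apply: univoque_admissible => // e; rewrite /is_expansion -d1 => e1.
by apply/esym/du.
Qed.

Lemma univoque_base_max : (0 < M)%N -> univoque_bases M (M.+1%:R : R).
Proof.
move=> M0; have q1 : 1 < M.+1%:R :> R by rewrite ltr1n.
have z0 : expansion_value (M.+1%:R : R) (fun=> ord0 : 'I_M.+1) = 0.
  rewrite /expansion_value (_ : series _ = fun=> 0) ?lim_cst//.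
  by apply/funext => n; rewrite seriesEnat /= big1// => i _; rewrite mul0r.
have barM : bar (fun=> ord_max) = fun=> ord0 :> 'I_M.+1.
  by apply/funext => i; apply/val_inj; rewrite /bar /= subnn.
apply: (@admissible_base _ (fun=> ord_max)) => //.
  have : expansion_value (M.+1%:R : R) (bar (fun=> @ord_max M)) = 0 by rewrite barM z0.
  rewrite expansion_bar// -natr1 addrK divff ?pnatr_eq0 -?lt0n//; lra.
by move=> n; split=> [|_]; [rewrite /= ltnn|rewrite barM z0 ltr01].
Qed.

(* The leading digit 0 makes the expansion of 1 in base p a tail that rules out base q but not base r. *)
Lemma scons_univoque p q r d : 1 < q -> q <= M.+1%:R -> (0 < M)%N -> q < p -> p < r ->
  expansion_value p d = 1 -> admissible p d ->
  (univoque_seqs M r `\` univoque_seqs M q) (scons ord0 d).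
Proof.
move=> q1 qM M0 qp pr d1 ad; split.
  apply: admissible_univoque; [lra|case=> [|n]].
    split => //= _; rewrite tail1_scons.
    have := expansion_mono d (lt_trans q1 qp) (ltW pr); rewrite d1; nra.
  exact: (admissible_le (lt_trans q1 qp) (ltW pr) ad n).
move/(univoque_admissible q1 qM)/(_ 0%N) => -[/(_ M0)].
rewrite tail1_scons => h _; have := expansion_le d q1 (ltW qp); lra.
Qed.

End Univoque.

Section Hausdorff_dimension.
Context {R : realType}.
Implicit Types (A : set R) (s : R).
Local Open Scope ereal_scope.

Lemma diam1 (x : R) : diam [set x] = 0.
Proof.
rewrite /diam (_ : [set _ | _ in _ & _ in _] = [set 0]) ?ereal_sup1//.
apply/seteqP; split => [_ [_ -> [_ -> <-]]|_ ->] /=; first by rewrite subrr normr0.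
by exists x => //; exists x => //; rewrite subrr normr0.
Qed.

Lemma hausdorff_weight_ge0 s A : 0 <= hausdorff_weight s A.
Proof. by rewrite /hausdorff_weight; case: ifP => // _; exact: poweR_ge0. Qed.

Lemma hausdorff_content_ge0 s delta A : 0 <= hausdorff_content s delta A.
Proof.
apply: le_ereal_inf_tmp => _ [F _ <-].
by apply: nneseries_ge0 => i _ _; exact: hausdorff_weight_ge0.
Qed.

Lemma hausdorff_dim_countable A : countable A -> hausdorff_dim A <= 0.
Proof.
move=> /pcard_surjP[g gA]; apply/lee_addgt0Pr => s s0; rewrite add0e.
apply: ereal_inf_lbound; exists s => //; split; first exact: ltW.
apply/eqP; rewrite eq_le; apply/andP; split.
  apply: ge_ereal_sup => _ [delta d0 <-]; apply: ereal_inf_lbound.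
  exists (fun i => [set g i]); first split.
  - by move=> x /gA[i _ <-]; exists i.
  - by move=> i; rewrite diam1 lee_fin ltW.
  apply: eseries0 => i _ _; rewrite /hausdorff_weight diam1 poweR0r ?if_same//.
  by rewrite gt_eqF.
apply: le_trans (hausdorff_content_ge0 s 1 A) _.
by apply: ereal_sup_ubound; exists 1%R => //=.
Qed.

(* By the geometric separation, the binary number with digits x depends on g x in a Hölder
   continuous way; this maps covers of A to covers of the unit interval. *)
Lemma hausdorff_dim_gt0 A (g : (nat -> 'I_2) -> R) (K : nat) : (0 < K)%N ->
  (forall x, A (g x)) ->
  (forall x y j, (forall i, (i < j)%N -> x i = y i) -> x j <> y j ->
    ((1 / 2) ^+ (K * j.+1) <= `|g x - g y|)%R) ->
  0 < hausdorff_dim A.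
Proof.
move=> K0 gA gsep.
have s0 : (0 < (K%:R^-1 : R))%R by rewrite invr_gt0 ltr0n.
have two1 : (1 < 2 :> R)%R by rewrite ltr1n.
pose h (x : nat -> 'I_2) : R := expansion_value 2 x.
have hprefix x y n : (forall i, (i < n)%N -> x i = y i) -> (h x - h y <= 2 * (1 / 2) ^+ n.+1)%R.
  move=> xy; apply: le_trans (expansion_prefix_le two1 xy) _.
  rewrite expr_div_n expr1n exprS [leLHS](_ : _ = 2 * (1 / (2 * 2 ^+ n)))%R//.
  by field; rewrite expf_neq0.
have holder x y : (`|h x - h y| <= 2 * `|g x - g y| `^ K%:R^-1)%R.
  have [->|/first_difference[j [xy ne]]] := pselect (x = y).
    by rewrite !subrr normr0 mulr_ge0// powR_ge0.
  apply: (@le_trans _ _ (2 * (1 / 2) ^+ j.+1))%R.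
    by rewrite ler_norml lerNl opprB !hprefix// => i ij; rewrite xy.
  apply: ler_wpM2l => //.
  rewrite (_ : ((1 / 2) ^+ j.+1 = ((1 / 2) ^+ (K * j.+1)) `^ K%:R^-1)%R).
    by apply: ge0_ler_powR; rewrite ?nnegrE ?exprn_ge0 ?normr_ge0 ?(ltW s0)//; exact: gsep.
  rewrite mulnC exprM -(powR_mulrn K) ?exprn_ge0// -powRrM divff ?powRr1 ?exprn_ge0//.
  by rewrite pnatr_eq0 -lt0n.
have content s : (0 <= s <= K%:R^-1)%R -> (1 / 4)%:E <= hausdorff_content s 1 A.
  move=> /andP[s_ge0 s_le]; apply: le_ereal_inf_tmp => _ [F [AF dF] <-].
  have /choice[J HJ] : forall i, exists J : set R, [/\ measurable J,
      lebesgue_measure J <= 4%:E * hausdorff_weight s (F i) &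
      forall y, F i (g y) -> J (h y)].
    move=> i; have [[x Fx]|nF] := pselect (exists x, F i (g x)); last first.
      exists set0; split => //; last by move=> y Fy; apply: nF; exists y.
      by rewrite measure0 mule_ge0// hausdorff_weight_ge0.
    have dle y : F i (g y) -> `|g x - g y|%:E <= diam (F i).
      by move=> Fy; apply: ereal_sup_ubound; exists (g x) => //; exists (g y).
    have d0 : 0 <= diam (F i) by apply: le_trans (dle _ Fx); rewrite lee_fin.
    have dfin : diam (F i) \is a fin_num.
      by rewrite ge0_fin_numE// (le_lt_trans (dF i))// ltry.
    have [r rE] : exists r : R, diam (F i) = r%:E.
      by exists (fine (diam (F i))); rewrite fineK.
    have r1 : (r <= 1)%R by rewrite -lee_fin -rE.
    have r0 : (0 <= r)%R by rewrite -lee_fin -rE.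
    have ge0 := powR_ge0 r s.
    exists `[(h x - 2 * r `^ s)%R, (h x + 2 * r `^ s)%R]%classic; split => //.
      rewrite lebesgue_measure_itv /= /hausdorff_weight.
      have /negPf -> : F i != set0 by apply/set0P; exists (g x).
      rewrite rE poweR_EFin -EFinM; case: ifP => _; rewrite ?lee_fin; last by lra.
      by lra.
    move=> y Fy /=; rewrite in_itv /=.
    have gr : (`|g x - g y| <= r)%R by rewrite -lee_fin -rE dle.
    have : (`|g x - g y| `^ K%:R^-1 <= r `^ s)%R.
      have [->|ne] := eqVneq (`|g x - g y|)%R 0%R; first by rewrite powR0 ?gt_eqF.
      apply: (@le_trans _ _ (`|g x - g y| `^ s)%R).
        by apply: ger_powR => //; rewrite normr_gt0 -normr_eq0 ne (le_trans gr).
      by apply: ge0_ler_powR.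
    move=> le.
    by rewrite -ler_distlC (le_trans (holder x y))// ler_pM2l.
  have sub : `[0%R, 1%R]%classic `<=` \bigcup_i J i.
    move=> t /=; rewrite in_itv/= => /andP[t0 t1].
    have [x ->] : exists x : nat -> 'I_2, t = h x.
      by apply: expansion_exists => //; rewrite (_ : 2 - 1 = 1)%R ?divr1//; ring.
    by have [i _ Fi] := AF _ (gA x); exists i => //; have [_ _] := HJ i; exact.
  have mJ i : measurable (J i) by have [] := HJ i.
  have le1 : 1 <= \sum_(0 <= i <oo) lebesgue_measure (J i).
    rewrite [X in X <= _](_ : _ = lebesgue_measure (`[0%R, 1%R]%classic : set R)).
      exact: measure_sigma_subadditive.
    by rewrite lebesgue_measure_itv /= lte_fin ltr01 oppr0 adde0.
  have : 1 <= 4%:E * \sum_(0 <= i <oo) hausdorff_weight s (F i).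
    rewrite -nneseriesZl; last by move=> i _; exact: hausdorff_weight_ge0.
    apply: le_trans le1 _; apply: lee_nneseries => i _ //.
    by have [] := HJ i.
  move=> /(@lee_wpmul2l _ (1 / 4)%R%:E); rewrite lee_fin => /(_ ltac:(lra)).
  by rewrite mule1 muleA -EFinM (_ : 1 / 4 * 4 = 1)%R ?mul1e//; field.
suff : (K%:R^-1)%:E <= hausdorff_dim A by apply: lt_le_trans; rewrite lte_fin.
apply: le_ereal_inf_tmp => _ [s [s_ge0 sA] <-]; rewrite lee_fin leNgt; apply/negP => lts.
have : (1 / 4)%:E <= hausdorff_measure s A.
  apply: le_trans (content s _) _; first by rewrite s_ge0 ltW.
  by apply: ereal_sup_ubound; exists 1%R => //=.
by rewrite sA lee_fin; lra.
Qed.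

End Hausdorff_dimension.

Lemma konig (T : finType) (E : nat -> set (nat -> T)) :
  (forall m n, (m <= n)%N -> E n `<=` E m) -> (forall n, E n !=set0) ->
  exists f, forall n K, exists2 e, E n e & forall i, (i < K)%N -> e i = f i.
Proof.
move=> Edec E0.
pose Q K (f : nat -> T) := forall n, exists2 e, E n e & forall i, (i < K)%N -> e i = f i.
have ext K f : Q K f -> exists g, Q K.+1 g /\ forall i, (i < K)%N -> g i = f i.
  move=> Qf; apply: contrapT => noext.
  pose g c i := if (i < K)%N then f i else c.
  have /choice[N HN] : forall c, exists n, forall e, E n e ->
      ~ forall i, (i < K.+1)%N -> e i = g c i.
    move=> c; apply: contrapT => H; apply: noext; exists (g c).
    split=> [n|i iK]; last by rewrite /g iK.
    apply: contrapT => H'; apply: H; exists n => e Ee eg; apply: H'.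
    by exists e.
  have [e Ee ef] := Qf (\max_c N c).
  apply: (HN (e K) e); first exact: Edec (leq_bigmax _) _ Ee.
  move=> i; rewrite ltnS leq_eqVlt /g => /orP[/eqP->|iK]; first by rewrite ltnn.
  by rewrite iK ef.
have [f0 _] := E0 0%N.
have /choice[s sP] : forall Kf : nat * (nat -> T), exists g, Q Kf.1 Kf.2 ->
    Q Kf.1.+1 g /\ forall i, (i < Kf.1)%N -> g i = Kf.2 i.
  move=> [K f]; have [Qf|nQ] := pselect (Q K f); last by exists f.
  by have [g Hg] := ext K f Qf; exists g.
pose F := fix F K := if K is K'.+1 then s (K', F K') else f0.
have QF K : Q K (F K).
  elim: K => [|K IH]; last by have [] := sP (K, F K) IH.
  by move=> n; have [e Ee] := E0 n; exists e.
have agree K i : (i < K)%N -> F K i = F i.+1 i.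
  elim: K => // K IH; rewrite ltnS leq_eqVlt => /orP[/eqP->//|iK].
  by rewrite -IH//; have [_ H] := sP (K, F K) (QF K); exact: H.
exists (fun i => F i.+1 i) => n K.
by have [e Ee ef] := QF K n; exists e => // i iK; rewrite ef// agree.
Qed.

Section Countability.
Context {R : realType} {M : nat}.
Implicit Types (q r : R) (d e f : nat -> 'I_M.+1).

Definition weakly_admissible q d := forall n,
  ((d n < M)%N -> expansion_value q (tail n.+1 d) <= 1) /\
  ((0 < d n)%N -> expansion_value q (tail n.+1 (bar d)) <= 1).

Lemma admissibleW q d : admissible q d -> weakly_admissible q d.
Proof. by move=> ad n; have [h1 h2] := ad n; split => h; apply/ltW; auto. Qed.

Lemma weakly_admissible_bar q d :
  weakly_admissible q d -> weakly_admissible q (bar d).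
Proof.
by move=> wd n; have [h1 h2] := wd n; rewrite bar_ltM bar_gt0 barK; split.
Qed.

Lemma weakly_admissible_tail q d n :
  weakly_admissible q d -> weakly_admissible q (tail n d).
Proof.
by move=> wd m; have := wd (n + m)%N; rewrite bar_tail !tail_tail !addnS.
Qed.

Lemma weakly_admissible_le q r d : 1 < q -> q <= r ->
  weakly_admissible q d -> weakly_admissible r d.
Proof.
move=> q1 qr wd n; have [h1 h2] := wd n; split => h.
  exact: le_trans (expansion_le _ q1 qr) (h1 h).
exact: le_trans (expansion_le _ q1 qr) (h2 h).
Qed.

Lemma weakly_admissible_inj q d e : 1 < q -> q < M.+1%:R ->
  weakly_admissible q d -> weakly_admissible q e ->
  expansion_value q d = 1 -> expansion_value q e = 1 -> d = e.
Proof.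
move=> q1 qM.
have aux d' e' k : weakly_admissible q d' -> weakly_admissible q e' ->
    expansion_value q d' = 1 -> expansion_value q e' = 1 ->
    (forall i, (i < k)%N -> d' i = e' i) -> ~ (d' k < e' k)%N.
  move=> wd we d1 e1 de dk.
  have qk : 0 < q ^+ k.+1 by rewrite exprn_gt0//; lra.
  have := expansion_first_difference q1 de dk.
  rewrite d1 e1 subrr pmulr_lle0 ?invr_gt0// => le0.
  have [/(_ (leq_trans dk (leq_ord _))) h1 _] := wd k.
  have [_ /(_ (leq_ltn_trans (leq0n _) dk))] := we k.
  rewrite -bar_tail expansion_bar//.
  have : 1 < M%:R / (q - 1).
    by rewrite ltr_pdivlMr ?subr_gt0// mul1r; move: qM; rewrite -natr1; lra.
  lra.
move=> wd we d1 e1; apply: contrapT => /first_difference[k [kE]].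
move/eqP; rewrite -val_eqE neq_ltn => /orP[lt|lt].
  by apply: (aux d e k).
by apply: (aux e d k) => // i ik; rewrite kE.
Qed.

Definition window q r : set (nat -> 'I_M.+1) :=
  [set e | [/\ weakly_admissible r e, expansion_value r e <= 1 &
               1 <= expansion_value q e]].

Lemma window_le q r r' : 1 < r -> r <= r' -> window q r `<=` window q r'.
Proof.
move=> r1 rr' e [we le1 ge1]; split => //; first exact: weakly_admissible_le we.
exact: le_trans (expansion_le _ r1 rr') le1.
Qed.

Let base q n : R := q + 1 / 2 ^+ n.

Let base_gt q n : q < base q n.
Proof. by rewrite ltrDl divr_gt0// exprn_gt0. Qed.

Let base_dec q m n : (m <= n)%N -> base q n <= base q m.
Proof.
move=> mn; rewrite lerD2l ler_pM2l// lef_pV2 ?posrE ?exprn_gt0//.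
by rewrite ler_eXn2l// ltr1n.
Qed.

Lemma limit_le1 q f : 1 < q ->
  (forall n K, exists2 e, expansion_value (base q n) e <= 1 &
     forall i, (i < K)%N -> e i = f i) -> expansion_value q f <= 1.
Proof.
move=> q1 H; rewrite leNgt; apply/negP => gt1.
have c0 : 0 < (expansion_value q f - 1) / 2 by lra.
have [K HK] := ltr_exp_small (M%:R / (q - 1)) q1 c0.
have two1 : 1 < 2 :> R by lra.
have [n Hn] := ltr_exp_small (M%:R / (q - 1) ^+ 2) two1 c0.
have [e e1 ef] := H n K.
have := expansion_prefix_le q1 (fun i iK => esym (ef i iK)).
have := expansion_lipschitz e q1 (ltW (base_gt q n)).
rewrite [base q n - q]addrC addKr mul1r; lra.
Qed.

Lemma window_limit q (E : nat -> set (nat -> 'I_M.+1)) : 1 < q ->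
  (forall m n, (m <= n)%N -> E n `<=` E m) -> (forall n, E n !=set0) ->
  (forall n, E n `<=` window q (base q n)) ->
  exists f, [/\ weakly_admissible q f, expansion_value q f = 1 &
    forall n K, exists2 e, E n e & forall i, (i < K)%N -> e i = f i].
Proof.
move=> q1 Edec E0 EW; have [f Hf] := konig Edec E0; exists f; split => //.
  move=> n; split => fn; apply: limit_le1 => // k K.
    have [e /EW[we _ _] ef] := Hf k (n.+1 + K)%N; exists (tail n.+1 e).
      by have [-> //] := we n; rewrite ef// addSn ltnS leq_addr.
    by move=> i iK; rewrite /tail ef// ltn_add2l.
  have [e /EW[we _ _] ef] := Hf k (n.+1 + K)%N; exists (tail n.+1 (bar e)).
    by have [_ -> //] := we n; rewrite ef// addSn ltnS leq_addr.
  by move=> i iK; rewrite /tail /bar ef// ltn_add2l.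
apply/eqP; rewrite eq_le; apply/andP; split.
  apply: limit_le1 => // n K; have [e /EW[_ e1 _] ef] := Hf n K.
  by exists e.
rewrite leNgt; apply/negP => lt1.
have c0 : 0 < 1 - expansion_value q f by lra.
have [K HK] := ltr_exp_small (M%:R / (q - 1)) q1 c0.
have [e /EW[_ _ e1] ef] := Hf 0%N K.
have := expansion_prefix_le q1 ef; lra.
Qed.

Lemma limit_periodic q f : 1 < q -> q < M.+1%:R -> ~ univoque_bases M q ->
  weakly_admissible q f -> expansion_value q f = 1 ->
  exists2 m, tail m.+1 f = f & (f m < M)%N.
Proof.
move=> q1 qM nu wf f1.
have /existsNP[n /not_andP nad] : ~ admissible q f.
  by move=> /(admissible_base q1 f1).
case: nad => /not_implyP[fn /negP]; rewrite -leNgt => ge1.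
  exists n => //; apply: (weakly_admissible_inj q1 qM _ wf _ f1).
    exact: weakly_admissible_tail.
  by apply/eqP; rewrite eq_le ge1 (wf n).1.
have barE : tail n.+1 (bar f) = f.
  apply: (weakly_admissible_inj q1 qM _ wf _ f1).
    exact/weakly_admissible_tail/weakly_admissible_bar.
  by apply/eqP; rewrite eq_le ge1 (wf n).2.
have barE' : bar f = tail n.+1 f by rewrite -{1}barE bar_tail barK.
exists (n.+1 + n)%N; first by rewrite -addnS -tail_tail -barE'.
by rewrite -[f _]/(tail n.+1 f n) -barE' bar_ltM.
Qed.

(* The limit sequence of the windows is periodic, and following a sequence of a small
   window through one period leads back into that window. *)
Lemma window_subset1 q : 1 < q -> q < M.+1%:R -> ~ univoque_bases M q ->
  exists2 r, q < r <= M.+1%:R & exists f, window q r `<=` [set f].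
Proof.
move=> q1 qM nu.
suff [n [f Hf]] : exists n f, window q (base q n) `<=` [set f].
  exists (Num.min (base q n) M.+1%:R).
    by rewrite lt_min base_gt qM ge_min lexx orbT.
  exists f; apply: subset_trans Hf; apply: window_le.
    by rewrite lt_min (lt_trans q1 (base_gt q n)) (lt_trans q1 qM).
  by rewrite ge_min lexx.
have base1 n : 1 < base q n by apply: lt_trans q1 (base_gt q n).
have Wdec m n : (m <= n)%N -> window q (base q n) `<=` window q (base q m).
  by move=> mn; apply: window_le => //; exact: base_dec.
have [W0|/existsNP[n /set0P/negP]] := pselect (forall n, window q (base q n) !=set0); last first.
  by rewrite negbK => /eqP W0; exists n, (fun=> ord0); rewrite W0.
have [f [wf f1 _]] := window_limit q1 Wdec W0 (fun n => @subset_refl _ _).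
have [m fm fmM] := limit_periodic q1 qM nu wf f1.
have [n Hn] : exists n, forall e, window q (base q n) e ->
    forall i, (i < m.+1)%N -> e i = f i.
  apply: contrapT => H.
  pose E n := window q (base q n) `&` [set e | ~ forall i, (i < m.+1)%N -> e i = f i].
  have [||| g [wg g1 Hg]] := @window_limit q E q1.
  - by move=> a b ab e [We ne]; split => //; exact: Wdec We.
  - move=> n; apply: contrapT => nE; apply: H; exists n => e We.
    by apply: contrapT => ne; apply: nE; exists e.
  - by move=> n e [].
  have [e [_ ne]] := Hg 0%N m.+1.
  by rewrite (weakly_admissible_inj q1 qM wg wf g1 f1).
exists n, f => e We /=.
have Wtail e' : window q (base q n) e' -> window q (base q n) (tail m.+1 e').
  move=> We'; have e'f := Hn _ We'; case: We' => we' le1 ge1; split.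
  - exact: weakly_admissible_tail.
  - by apply: (we' m).1; rewrite e'f.
  - have := expansion_prefix q1 e'f; rewrite fm f1.
    have qm : 0 < q ^+ m.+1 by rewrite exprn_gt0//; lra.
    have : 0 <= expansion_value q e' - 1 by lra.
    by move=> + eqV; rewrite eqV pmulr_lge0 ?invr_gt0//; lra.
have Wk k : window q (base q n) (tail (k * m.+1) e).
  by elim: k => [|k IH]; [rewrite mul0n tail0|rewrite mulSn addnC -tail_tail; apply: Wtail].
have fk k : tail (k * m.+1) f = f.
  by elim: k => [|k IH]; [rewrite mul0n tail0|rewrite mulSn -tail_tail fm].
apply/funext => i; rewrite (divn_eq i m.+1).
rewrite -[LHS]/(tail (i %/ m.+1 * m.+1)%N e (i %% m.+1)%N) (Hn _ (Wk _)) ?ltn_pmod//.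
by rewrite -[in LHS](fk (i %/ m.+1)%N).
Qed.

Lemma univoque_seqs_countable q : 1 < q -> q < M.+1%:R -> ~ univoque_bases M q ->
  exists2 r, q < r <= M.+1%:R &
    countable (univoque_seqs M r `\` univoque_seqs M q).
Proof.
move=> q1 qM nu; have [r /andP[qr rM] [f Hf]] := window_subset1 q1 qM nu.
exists r; first by rewrite qr.
have inW e : weakly_admissible r e -> expansion_value r e < 1 ->
    ~ expansion_value q e < 1 -> e = f.
  by move=> we /ltW er /negP; rewrite -leNgt => eq; apply: Hf; split.
pose dec (bs : bool * seq 'I_M.+1) i :=
  if (i < size bs.2)%N then nth ord0 bs.2 i
  else (if bs.1 then f else bar f) (i - size bs.2)%N.
have decE b n d : splice n d (if b then f else bar f) = dec (b, [seq d i | i <- iota 0 n]).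
  apply/funext => i; rewrite /splice /dec /= size_map size_iota.
  by case: ltnP => // ni; rewrite (nth_map 0%N) ?size_iota// nth_iota.
apply: (@sub_countable _ _ _ (range dec)).
  apply: subset_card_le => d [ud nud].
  have ad : admissible r d by apply: univoque_admissible => //; lra.
  have /existsNP[n /not_andP] : ~ admissible q d.
    by move=> /(admissible_univoque q1).
  case=> /not_implyP[dn h].
    exists (true, [seq d i | i <- iota 0 n.+1]) => //.
    rewrite -decE/= -(inW (tail n.+1 d)) ?splice_tail//; last exact: (ad n).1.
    exact/weakly_admissible_tail/admissibleW.
  exists (false, [seq d i | i <- iota 0 n.+1]) => //.
  rewrite -decE/= -(inW (tail n.+1 (bar d)))//; last exact: (ad n).2.
    by rewrite bar_tail barK splice_tail.
  exact/weakly_admissible_tail/weakly_admissible_bar/admissibleW.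
apply: sub_countable (countableP [set: bool * seq 'I_M.+1]).
exact: card_image_le.
Qed.

End Countability.

Section Blocks.
Local Open Scope nat_scope.

Definition lexlt (M : nat) (d e : nat -> 'I_M.+1) :=
  exists2 k, (forall i, i < k -> d i = e i :> nat) & d k < e k.

Fixpoint block_sign (s : bool) (t : nat -> bool) (j : nat) : bool :=
  if j is j'.+1 then block_sign s t j' (+) t j' else s.

Lemma block_signD s t i j :
  block_sign s t (i + j) = block_sign (block_sign s t i) (tail i t) j.
Proof. by elim: j => [|j IH]; rewrite ?addn0 ?addnS//= IH. Qed.

Lemma block_signN s t j : block_sign (~~ s) t j = ~~ block_sign s t j.
Proof. by elim: j => //= j ->; rewrite addNb. Qed.

Lemma eq_block_sign s t t' j : (forall i, i < j -> t i = t' i) ->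
  block_sign s t j = block_sign s t' j.
Proof.
elim: j => //= j IH tt'; rewrite tt'// IH// => i ij; apply: tt'.
exact: ltn_trans ij _.
Qed.

Context {M : nat} (a : nat -> 'I_M.+1).
Implicit Types t : nat -> bool.
Context (tail_lt : forall n, lexlt (tail n.+1 a) a).
Context (bar_tail_lt : forall n, lexlt (tail n.+1 (bar a)) a).

(* A border of the prefix of length N would be a shift that agrees with a up to N;
   as a dominates its shifts, a first disagreement before N is strict this way. *)
Definition unbordered (N : nat) := forall m, 0 < m -> m < N ->
  exists k, [/\ (m + k < N), (forall i, i < k -> a (m + i) = a i :> nat) &
    (a (m + k) < a k)].

(* N is the length of the longest comparison among the first L shifts: a border of that
   prefix would make some later shift exceed a. *)
Lemma unbordered_exists L : (0 < L) -> exists2 N, (L < N) & unbordered N.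
Proof.
move=> L0.
have /choice[kk kkP] : forall n, exists k,
    (forall i, i < k -> a (n.+1 + i) = a i :> nat) /\ (a (n.+1 + k) < a k).
  by move=> n; have [k h1 h2] := tail_lt n; exists k.
have [|n0 n0E] := @bigop.eq_bigmax 'I_L (fun n => n.+1 + kk n).
  by rewrite card_ord.
pose N := (n0.+1 + kk n0).+1.
have Nmax (n : 'I_L) : (n.+1 + kk n < N).
  by rewrite ltnS -n0E; exact: (leq_bigmax (F := fun n : 'I_L => n.+1 + kk n)).
exists N.
  by have := Nmax (Ordinal (n := L) (m := L.-1) (eq_leq (prednK L0))); rewrite /= prednK//; lia.
case=> // m _ mN; have [k1 k2] := kkP m.
have [lt|ge] := ltnP (m.+1 + kk m) N; first by exists (kk m).
exfalso.
have Lm : (L <= m).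
  rewrite leqNgt; apply/negP => mL; have /= := Nmax (Ordinal mL); lia.
have [h1 h2] := kkP n0; have n0L := ltn_ord n0.
have [k hk1 hk2] := tail_lt (m - n0.+1).
have [r rE] : exists r, (m.+1 + r).+1 = N by exists (N - m.+2); rewrite /N; lia.
have shiftE i : (i < r) -> a ((m - n0.+1).+1 + i) = a i :> nat.
  move=> ir; rewrite -(k1 i); last by lia.
  rewrite -(h1 ((m - n0.+1).+1 + i)); last by rewrite /N in rE; lia.
  by congr (val (a _)); lia.
have kr : (k < r) = false.
  apply/negP => kr; move: hk2; rewrite /tail shiftE// ltnn//.
have rk : (r <= k) by rewrite leqNgt kr.
have ge' : (a ((m - n0.+1).+1 + r) <= a r).
  move: rk; rewrite leq_eqVlt => /orP[/eqP->|/hk1]; first exact: ltnW.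
  by rewrite /tail => ->.
have e1 : a ((m - n0.+1).+1 + r) = a (kk n0) by congr (a _); rewrite /N in rE; lia.
have e2 : a r = a (n0.+1 + kk n0) :> nat.
  by rewrite -(k1 r); [congr (val (a _)); rewrite /N in rE; lia|lia].
by move: ge'; rewrite e1 e2 leqNgt h2.
Qed.

Context {N : nat} (N1 : 1 < N) (aN : unbordered N).

Let last_lt : (a N.-1 < a 0).
Proof.
have [||[|k] []] := aN (m := N.-1); try lia.
by rewrite addn0.
Qed.

Let last_ltM : (a N.-1 < M).
Proof. by apply: leq_trans last_lt _; rewrite -ltnS. Qed.

Let bar0_lt : (M - a 0 < a 0).
Proof.
have [k h1 h2] := bar_tail_lt N.-2.
have e : (N.-2.+1 = N.-1) by lia.
have : (M - a N.-1 <= a 0).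
  case: k h1 h2 => [|k] h1 h2.
    by move: h2; rewrite /tail addn0 barE e => /ltnW.
  by have := h1 0 isT; rewrite /tail addn0 barE e => <-.
have := ltn_ord (a 0); lia.
Qed.

(* The blocks of block_seq are u or u+ (u with its last digit raised by 1), each of them
   reflected or not, where u is the prefix of length N of a: t says which blocks are
   raised, and the reflection toggles after each raised block. *)
Definition block_digit (s b : bool) (m : nat) : nat :=
  let v := (a m + (b && (m == N.-1))) in if s then (M - v) else v.

Definition block_seq (s : bool) (t : nat -> bool) : nat -> 'I_M.+1 :=
  fun i => inord (block_digit (block_sign s t (i %/ N)) (t (i %/ N)) (i %% N)).

Lemma block_digit_le s (b : bool) m : block_digit s b m <= M.
Proof.
have := ltn_ord (a m); have := last_ltM; rewrite /block_digit.
have [->|_] := eqVneq m N.-1; case: s; case: b => /=; lia.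
Qed.

Lemma block_seqE s t j i : (i < N) ->
  block_seq s t (j * N + i) = block_digit (block_sign s t j) (t j) i :> nat.
Proof.
move=> iN; have N0 : (0 < N) by lia.
rewrite inordK ?ltnS ?block_digit_le//.
by rewrite divnMDl// divn_small// addn0 modnMDl modn_small.
Qed.

Lemma block_seq0E s t i : (i < N) ->
  block_seq s t i = block_digit s (t 0) i :> nat.
Proof. by move=> iN; rewrite -[i in LHS]add0n -(mul0n N) block_seqE. Qed.

Lemma block_seq1E s t i : (i < N) ->
  block_seq s t (N + i) = block_digit (s (+) t 0) (t 1) i :> nat.
Proof. by move=> iN; rewrite -[X in (X + i)]mul1n block_seqE. Qed.

Lemma bar_block_seq s t : bar (block_seq s t) = block_seq (~~ s) t.
Proof.
apply/funext => i; apply/val_inj; rewrite [LHS]barE.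
have N0 : (0 < N) by lia.
rewrite (divn_eq i N) [RHS]block_seqE ?block_seqE ?ltn_pmod// block_signN.
move: (block_digit_le false (t (i %/ N)) (i %% N)).
by rewrite /block_digit; case: block_sign => /= h; rewrite ?subKn.
Qed.

Lemma tail_block_seq j s t :
  tail (j * N) (block_seq s t) = block_seq (block_sign s t j) (tail j t).
Proof.
have N0 : (0 < N) by lia.
apply/funext => i; apply/val_inj; rewrite /tail.
rewrite {1}(divn_eq i N) addnA -mulnDl [LHS]block_seqE ?ltn_pmod//.
by rewrite [in RHS](divn_eq i N) [RHS]block_seqE ?ltn_pmod// block_signD.
Qed.

Let lex_prefix_bar m (D : nat -> nat) : 0 < m -> m < N ->
  (forall i, (i < N - m) -> D i = a i) ->
  (forall i, i < m -> D (N - m + i) = (M - a i)) ->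
  exists2 k, (forall i, i < k -> D i = (a i + (i == N.-1))) &
    (k < N) && (D k < a k + (k == N.-1)).
Proof.
move=> m0 mN Dlo Dhi; pose m' := (N - m).
have [k h1 h2] := bar_tail_lt m'.-1.
have m'E : (m'.-1.+1 = m') by rewrite /m'; lia.
have h1' i : i < k -> (M - a (m' + i) = a i).
  by move=> /h1; rewrite /tail barE m'E.
have {h2} h2' : (M - a (m' + k) < a k) by move: h2; rewrite /tail barE m'E.
have Deq i : (i < minn N.-1 (m' + k)) -> D i = (a i + (i == N.-1)).
  rewrite leq_min => /andP[iN ik]; rewrite (ltn_eqF iN) addn0.
  have [lt|ge] := ltnP i m'; first exact: Dlo.
  have -> : i = (m' + (i - m')) by lia.
  rewrite Dhi; last by rewrite /m' in ge *; lia.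
  have := h1' (i - m'); have := ltn_ord (a (m' + (i - m'))); lia.
have [km|mk] := ltnP k m.
  exists (m' + k); first by move=> i ik; apply: Deq; rewrite leq_min ik andbT; rewrite /m' in ik; lia.
  rewrite Dhi//; apply/andP; split; first by rewrite /m'; lia.
  have := ltn_ord (a (m' + k)); have := ltn_ord (a k); lia.
exists N.-1; first by move=> i ik; apply: Deq; rewrite leq_min ik /m'; lia.
have -> : N.-1 = (m' + m.-1) by rewrite /m'; lia.
rewrite Dhi; last by lia.
rewrite -(h1' m.-1); last by lia.
have e : (m' + m.-1 = N.-1) by rewrite /m'; lia.
rewrite e eqxx; have := ltn_ord (a (N.-1)); lia.
Qed.

Lemma block_seq_lt_inside m s t t' : 0 < m -> m < N -> t 0 ->
  lexlt (tail m (block_seq s t')) (block_seq false t).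
Proof.
move=> m0 mN t0; pose D i : nat := tail m (block_seq s t') i.
have E i : (i < N) -> block_seq false t i = (a i + (i == N.-1)) :> nat.
  by move=> iN; rewrite block_seq0E// /block_digit t0.
suff [k h1 /andP[kN h2]] : exists2 k, (forall i, i < k -> D i = (a i + (i == N.-1))) &
    (k < N) && (D k < a k + (k == N.-1)).
  by exists k => [i ik|]; rewrite E//; [exact: h1|exact: ltn_trans ik kN].
have Dlo i : (i < N - m) -> D i = block_digit s (t' 0) (m + i).
  by move=> iN; rewrite /D /tail block_seq0E//; lia.
have Dhi i : i < m -> D (N - m + i) = if s (+) t' 0 then M - a i else a i.
  move=> im; rewrite /D /tail (_ : (m + (N - m + i) = N + i)); last by lia.
  rewrite block_seq1E; last by lia.
  by rewrite /block_digit (_ : (i == N.-1) = false) ?andbF ?addn0//; lia.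
clear E; clearbody D.
have inside i j : i < j -> j < N - m -> m + i < N.-1 by clear -N1; lia.
have inside_neq i : m + i < N.-1 -> (m + i == N.-1) = false /\ (i == N.-1) = false.
  by move=> lt; rewrite !ltn_eqF//; apply: leq_ltn_trans lt; rewrite leq_addl.
have lastE : m + (N - m).-1 = N.-1 by clear -mN; lia.
have last_inside : (N - m).-1 < N - m by clear -mN; lia.
have [k [kN h1 h2]] := aN m0 mN.
have [l g1 g2] := bar_tail_lt m.-1.
rewrite /tail prednK// barE in g2.
have {}g1 i : i < l -> M - a (m + i) = a i.
  by move=> /g1; rewrite /tail prednK// barE.
have kNm : k < N - m by rewrite ltn_subRL.
case: s Dlo Dhi; case: (t' 0) => /= Dlo Dhi; rewrite /block_digit /= in Dlo.
- have [lt|ge] := ltnP l (N - m).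
    exists l => [i il|]; last first.
      rewrite (leq_trans lt (leq_subr _ _)) Dlo//=.
      by apply: leq_ltn_trans (leq_sub2l _ (leq_addr _ _)) (leq_trans g2 (leq_addr _ _)).
    have [e1 e2] := inside_neq i (inside _ _ il lt).
    by rewrite Dlo ?(ltn_trans il lt)// e1 e2 !addn0 g1.
  exists (N - m).-1 => [i il|].
    have [e1 e2] := inside_neq i (inside _ _ il last_inside).
    rewrite Dlo ?(ltn_trans il last_inside)// e1 e2 !addn0 g1//.
    exact: leq_trans (ltn_trans il last_inside) ge.
  rewrite (leq_trans last_inside (leq_subr _ _)) Dlo// lastE eqxx /=.
  have := g1 (N - m).-1 (leq_trans last_inside ge); rewrite lastE => <-.
  by apply: leq_trans (leq_addr _ _); rewrite ltn_sub2l// addn1.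
- have [lt|ge] := ltnP l (N - m).
    exists l => [i il|]; last first.
      by rewrite (leq_trans lt (leq_subr _ _)) Dlo// addn0 (leq_trans g2 (leq_addr _ _)).
    have [e1 e2] := inside_neq i (inside _ _ il lt).
    by rewrite Dlo ?(ltn_trans il lt)// e2 !addn0 g1.
  apply: (lex_prefix_bar (m := m)) => // i im.
  by rewrite Dlo// addn0 g1// (leq_trans im ge).
- have [lt|ge] := boolP (a (m + k) + (m + k == N.-1) < a k).
    exists k => [i il|]; last first.
      by rewrite (leq_trans kNm (leq_subr _ _)) Dlo// (leq_trans lt (leq_addr _ _)).
    have [e1 e2] := inside_neq i (inside _ _ il kNm).
    by rewrite Dlo ?(ltn_trans il kNm)// e1 e2 !addn0 h1.
  move: ge; case: eqP => [kE|_]; last by rewrite addn0 h2.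
  rewrite -leqNgt addn1 => ge.
  apply: (lex_prefix_bar (m := m)) => // i im.
  have kE' : k = (N - m).-1 by clear -kE mN; lia.
  rewrite Dlo//; have [ik|ki] := ltnP i k.
    by have [-> _] := inside_neq i (inside _ _ ik kNm); rewrite addn0 h1.
  have -> : i = k by clear -ki im kE'; lia.
  by rewrite kE eqxx addn1; apply/eqP; rewrite eqn_leq -{1}kE h2 -kE.
- exists k => [i il|]; last first.
    by rewrite (leq_trans kNm (leq_subr _ _)) Dlo// addn0 (leq_trans h2 (leq_addr _ _)).
  have [e1 e2] := inside_neq i (inside _ _ il kNm).
  by rewrite Dlo ?(ltn_trans il kNm)// e2 !addn0 h1.
Qed.

Lemma block_seq_diff s t t' j : (forall i, i < j -> t' i = t i) -> t' j != t j ->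
  (forall i, (i < j * N + N.-1) -> block_seq s t' i = block_seq s t i) /\
  block_seq s t' (j * N + N.-1) <> block_seq s t (j * N + N.-1).
Proof.
move=> tt' tj; have N0 : (0 < N) by lia.
have sgE i : (i <= j) -> block_sign s t' i = block_sign s t i.
  by move=> ij; apply: eq_block_sign => h hi; apply: tt'; apply: leq_trans ij.
split=> [i|].
  rewrite (divn_eq i N) => lt; apply/val_inj => /=.
  have iN := ltn_pmod i N0.
  have le : (i %/ N <= j).
    rewrite -ltnS -(ltn_pmul2r N0) mulSn; apply: leq_ltn_trans (leq_addr (i %% N) _) _.
    by apply: leq_trans lt _; rewrite addnC leq_add2r leq_pred.
  rewrite !block_seqE// sgE//; move: le lt.
  rewrite leq_eqVlt => /orP[/eqP-> |lt _]; last by rewrite tt'.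
  by rewrite ltn_add2l => lt; rewrite /block_digit (ltn_eqF lt) !andbF.
move=> /(congr1 (@nat_of_ord _)); rewrite !block_seqE ?sgE ?prednK// /block_digit eqxx !andbT.
have := last_ltM; move: tj; case: (t' j); case: (t j); case: block_sign => //=; lia.
Qed.

Lemma block_seq_lt s t t' : t 0 -> ~~ t 1 -> ~~ t 2 -> (t' 0 -> t' 1 || t' 2) ->
  lexlt (block_seq s t') (block_seq false t).
Proof.
move=> t0 t1 t2 t'12; have N0 : (0 < N) by lia.
case: s.
  exists 0 => //; rewrite !block_seq0E// /block_digit t0 /=.
  have := bar0_lt; lia.
have lex j : (forall i, i < j -> t' i = t i) -> t' j != t j ->
    block_sign false t j = t' j -> lexlt (block_seq false t') (block_seq false t).
  move=> tt' tj sg; have [eq _] := block_seq_diff false tt' tj.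
  exists (j * N + N.-1); first by move=> i /eq ->.
  rewrite !block_seqE ?prednK// (eq_block_sign _ tt') sg /block_digit eqxx !andbT.
  by have := last_ltM; move: tj; case: (t' j); case: (t j) => //=; lia.
case t'0E: (t' 0); last by apply: (lex 0) => //=; rewrite t'0E ?t0.
move/(_ t'0E): t'12; case t'1E: (t' 1) => /= t'2.
  apply: (lex 1) => /=; first by case=> // _; rewrite t'0E t0.
    by rewrite t'1E.
  by rewrite t0 t'1E.
apply: (lex 2) => /=; last by rewrite t0 (negbTE t1) t'2.
  by case=> [|[|]]// _; rewrite ?t'0E ?t0// t'1E (negbTE t1).
by rewrite t'2 (negbTE t2).
Qed.

Lemma block_seq_shifts_lt t : t 0 -> ~~ t 1 -> ~~ t 2 ->
  (forall j, 0 < j -> t j -> t j.+1 || t j.+2) -> forall n,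
  lexlt (tail n.+1 (block_seq false t)) (block_seq false t) /\
  lexlt (tail n.+1 (bar (block_seq false t))) (block_seq false t).
Proof.
move=> t0 t1 t2 tj n; rewrite bar_block_seq; have N0 : (0 < N) by lia.
suff aux s : lexlt (tail n.+1 (block_seq s t)) (block_seq false t) by split.
rewrite (divn_eq n.+1 N) -tail_tail tail_block_seq.
have [m0|m0] := posnP (n.+1 %% N); last by apply: block_seq_lt_inside => //; rewrite ltn_pmod.
rewrite m0 tail0; apply: block_seq_lt => // tn; rewrite /tail addn1 addn2.
apply: tj; last by move: tn; rewrite /tail addn0.
rewrite divn_gt0//; apply: dvdn_leq => //; exact/eqP.
Qed.

End Blocks.

Section Lexicographic.
Context {R : realType} {M : nat}.
Implicit Types (p q r : R) (d e : nat -> 'I_M.+1).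

Lemma expansion_lt_lexlt q d e : 1 < q ->
  (forall n, expansion_value q (tail n.+1 e) <= 1) ->
  expansion_value q d < expansion_value q e -> lexlt d e.
Proof.
move=> q1 e1 lt.
have /first_difference[k [dE ne]] : d <> e by move=> de; move: lt; rewrite de ltxx.
exists k; first by move=> i /dE ->.
move: ne => /eqP; rewrite -val_eqE neq_ltn => /orP[//|lt'].
have := expansion_first_difference q1 (fun i ik => esym (dE i ik)) lt'.
have qk : 0 < q ^+ k.+1 by rewrite exprn_gt0//; lra.
have : 0 <= (1 + expansion_value q (tail k.+1 d) - expansion_value q (tail k.+1 e)) / q ^+ k.+1.
  apply: divr_ge0; last exact: ltW.
  by have := expansion_ge0 (tail k.+1 d) q1; have := e1 k; lra.
lra.
Qed.

(* A digit M in front of a tail of value at most 1 forces the next tail below q - M < 1. *)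
Lemma admissible_tails_lt1 q d : 1 < q -> q < M.+1%:R -> expansion_value q d = 1 ->
  admissible q d -> forall n, expansion_value q (tail n.+1 d) < 1 /\
                              expansion_value q (tail n.+1 (bar d)) < 1.
Proof.
move=> q1 qM d1 ad.
have step e n : expansion_value q (tail n e) <= 1 -> (M <= e n)%N ->
    expansion_value q (tail n.+1 e) < 1.
  move=> le1 en; have := expansion_mulE (tail n e) q1.
  rewrite tail_tail addn1 /tail addn0 -/(tail _ _).
  rewrite (_ : nat_of_ord (e n) = M); last by apply/eqP; rewrite eqn_leq en -ltnS ltn_ord.
  move: qM; rewrite -natr1; nra.
have d0 : (0 < d 0%N)%N.
  rewrite lt0n; apply/negP => /eqP d0; have := expansion_mulE d q1; rewrite d0 d1.
  have [h _] := ad 0%N; have [M0|M0] := posnP M; last first.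
    by have := h; rewrite d0 => /(_ M0); lra.
  by have M1 : M.+1%:R = 1 :> R; [rewrite M0|move: qM; rewrite M1; lra].
elim=> [|n [IH1 IH2]].
  have [h1 h2] := ad 0%N; split; last exact: h2.
  by have [|ge] := ltnP (d 0%N) M; [exact: h1|apply: step => //; rewrite tail0 d1].
have [h1 h2] := ad n.+1; split.
  by have [|ge] := ltnP (d n.+1) M; [exact: h1|apply: step ge; exact: ltW].
have [|ge] := ltnP 0 (d n.+1); first exact: h2.
by apply: step; [exact: ltW|rewrite barE; lia].
Qed.

Lemma lexlt_tails_le1 p d e : 1 < p -> expansion_value p d = 1 ->
  (forall n, lexlt (tail n e) d) -> forall n, expansion_value p (tail n e) <= 1.
Proof.
move=> p1 d1 lt n; rewrite -subr_le0; move: n.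
apply: (@contraction_le0 _ _ (fun n => expansion_value p (tail n e) - 1) p (M%:R / (p - 1))) => // n.
  by have := expansion_leM (tail n e) p1; lra.
move=> gt0; have [k kE klt] := lt n; exists (n + k.+1)%N.
have pk : 0 < p ^+ k.+1 by rewrite exprn_gt0//; lra.
have := expansion_first_difference p1 (fun i ik => val_inj (kE i ik)) klt.
rewrite d1 tail_tail => le.
set v := expansion_value p (tail (n + k.+1) e) in le *.
have le' : expansion_value p (tail n e) - 1 <= (v - 1) / p ^+ k.+1.
  have : 0 <= expansion_value p (tail k.+1 d) / p ^+ k.+1.
    by rewrite divr_ge0 ?expansion_ge0// ltW.
  by move: le; rewrite mulrBl mulrDl mulrBl; lra.
apply: (le_trans le').
have v0 : 0 <= v - 1.
  rewrite leNgt; apply/negP => v0.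
  have : (v - 1) / p ^+ k.+1 < 0 by rewrite pmulr_llt0 ?invr_gt0.
  lra.
apply: ler_wpM2l => //; rewrite lef_pV2 ?posrE//; last by lra.
by rewrite exprS ler_peMr ?exprn_ege1//; lra.
Qed.

Lemma lexlt_admissible p d : 1 < p -> p < M.+1%:R -> expansion_value p d = 1 ->
  (forall n, lexlt (tail n.+1 d) d /\ lexlt (tail n.+1 (bar d)) d) -> admissible p d.
Proof.
move=> p1 pM d1 lex.
have tail_le n : expansion_value p (tail n.+1 d) <= 1.
  rewrite -(add1n n) -tail_tail; apply: (lexlt_tails_le1 p1 d1) => m.
  by rewrite tail_tail add1n; exact: (lex m).1.
have bar_le n : expansion_value p (tail n.+1 (bar d)) <= 1.
  rewrite -(add1n n) -tail_tail; apply: (lexlt_tails_le1 p1 d1) => m.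
  by rewrite tail_tail add1n; exact: (lex m).2.
have tail_gt0 n : 0 < expansion_value p (tail n.+1 d).
  have := bar_le n; rewrite -bar_tail expansion_bar//.
  have : 1 < M%:R / (p - 1).
    by rewrite ltr_pdivlMr ?subr_gt0// mul1r; move: pM; rewrite -natr1; lra.
  lra.
have strict e : lexlt e d -> (forall n, expansion_value p (tail n.+1 e) <= 1) ->
    expansion_value p e < 1.
  move=> [k kE klt] le1.
  have := expansion_first_difference p1 (fun i ik => val_inj (kE i ik)) klt.
  have pk : 0 < p ^+ k.+1 by rewrite exprn_gt0//; lra.
  have : 0 < (1 + expansion_value p (tail k.+1 d) - expansion_value p (tail k.+1 e)) / p ^+ k.+1.
    by rewrite divr_gt0//; have := le1 k; have := tail_gt0 k; lra.
  by rewrite d1; lra.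
move=> n; split => _; apply: strict; [exact: (lex n).1| |exact: (lex n).2|] => m.
  by rewrite tail_tail addnS.
by rewrite tail_tail addnS.
Qed.

Lemma expansion_ivt q r d : 1 < q -> q < r ->
  1 < expansion_value q d -> expansion_value r d < 1 ->
  exists p, [/\ q < p, p < r & expansion_value p d = 1].
Proof.
move=> q1 qr dq dr.
have cont : {within `[q, r], continuous (fun p => expansion_value p d)}.
  apply: continuous_in_subspaceT => x; rewrite inE/= in_itv/= => /andP[qx xr].
  pose b := (1 + q) / 2; have b1 : 1 < b by rewrite /b; lra.
  have bx : b < x by rewrite /b; lra.
  pose C := M%:R / (b - 1) ^+ 2 + 1.
  have C0 : 0 < C.
    by rewrite ltr_wpDl// divr_ge0// exprn_ge0//; lra.
  apply/cvgrPdist_lt => eps eps0; near=> y.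
  have by_ : b < y.
    suff : `|x - y| < x - b by move=> /(le_lt_trans (ler_norm _)); lra.
    near: y; apply: (@cvgr_dist_lt _ _ _ (nbhs x) _ id x) => //.
    by rewrite subr_gt0.
  have xy : `|x - y| < eps / C.
    near: y; apply: (@cvgr_dist_lt _ _ _ (nbhs x) _ id x) => //.
    by rewrite divr_gt0.
  have aux s t : b < s -> s <= t ->
      `|expansion_value s d - expansion_value t d| <= C * (t - s).
    move=> bs st; rewrite ger0_norm; last by rewrite subr_ge0 expansion_le//; lra.
    apply: le_trans (expansion_lipschitz d _ st) _; first by lra.
    apply: ler_wpM2r; first by lra.
    rewrite /C; suff : (M%:R / (s - 1) ^+ 2 <= M%:R / (b - 1) ^+ 2) by lra.
    apply: ler_wpM2l => //; rewrite lef_pV2 ?posrE ?exprn_gt0//; [|lra|lra].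
    by apply: lerXn2r; rewrite ?nnegrE; lra.
  apply: (@le_lt_trans _ _ (C * `|x - y|)).
    have [xley|/ltW ylex] := leP x y.
      by rewrite [X in C * X]distrC [X in C * X]ger0_norm ?subr_ge0// aux.
    by rewrite [X in C * X]ger0_norm ?subr_ge0// distrC aux.
  by rewrite mulrC -ltr_pdivlMr.
have [|p pI p1] := IVT (v := 1) (ltW qr) cont.
  by rewrite ge_min le_max (ltW dq) (ltW dr) orbT.
exists p; move: pI; rewrite in_itv/= => /andP[qp pr].
by split=> //; rewrite lt_neqAle ?qp ?pr andbT; apply/eqP => pE; move: p1 dq dr; rewrite -?pE ?pE; lra.
Unshelve. all: by end_near. Qed.

End Lexicographic.

(* The pattern is 1, 0, 0, then alternately a forced 1 and a digit of x, so that two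
   consecutive 0s occur only right behind the initial 1. *)
Definition block_code (x : nat -> 'I_2) (i : nat) : bool :=
  if (i < 3)%N then i == 0%N else odd i || (x ((i - 4)./2) == ord_max).

Lemma block_code_dense x j : (0 < j)%N -> block_code x j ->
  block_code x j.+1 || block_code x j.+2.
Proof.
case: j => [|[|[|j]]]// _ _.
by rewrite /block_code /=; case: (odd j); rewrite ?orbT.
Qed.

Lemma block_code_diff x y j : (forall i, (i < j)%N -> x i = y i) -> x j <> y j ->
  (forall i, (i < 4 + j.*2)%N -> block_code x i = block_code y i) /\
  block_code x (4 + j.*2) != block_code y (4 + j.*2).
Proof.
move=> xy ne; split=> [i ij|].
  rewrite /block_code; case: ifP => // i3; case oi: (odd i) => //=.
  by rewrite xy// -ltn_double; lia.
rewrite /block_code ltnNge (leq_trans _ (leq_addr _ _))//= addKn doubleK odd_double/=.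
apply/eqP => e; apply: ne; apply/val_inj; move: e.
case: (x j) (y j) => [u hu] [v hv]; rewrite -!val_eqE /=.
by move: u v hu hv => [|[|u]] [|[|v]].
Qed.

Lemma geometric_rate {R : realType} (a c : R) (L : nat) : 1 < a -> 0 < c ->
  exists2 K, (0 < K)%N & forall j k, (k < L * j.+1)%N ->
    (1 / 2) ^+ (K * j.+1) <= c / a ^+ k.+1.
Proof.
move=> a1 c0; have two1 : 1 < 2 :> R by lra.
have [K1 HK1] := ltr_exp_small 1 two1 c0.
have [K2 HK2] := ltr_exp_small a two1 ltr01.
exists (K1 + K2 * L).+1 => // j k kL.
have le : (K1 + K2 * k.+1 <= (K1 + K2 * L).+1 * j.+1)%N by nia.
apply: (@le_trans _ _ ((1 / 2) ^+ (K1 + K2 * k.+1))).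
  by apply: ler_wiXn2l => //; lra.
rewrite exprD exprM; apply: ler_pM; rewrite ?exprn_ge0//; try lra.
  by rewrite expr_div_n expr1n ltW.
rewrite -exprVn; apply: lerXn2r; rewrite ?nnegrE ?exprn_ge0 ?invr_ge0//; try lra.
rewrite expr_div_n expr1n div1r lef_pV2 ?posrE ?exprn_gt0//; last lra.
by move: HK2; rewrite ltr_pdivrMr ?exprn_gt0// mul1r => /ltW.
Qed.

Section Cantor_family.
Context {R : realType} {M : nat}.
Implicit Types (p q r : R) (d e : nat -> 'I_M.+1).

Lemma cantor_family q r : univoque_bases M q -> q < r -> r < M.+1%:R ->
  exists (b : (nat -> 'I_2) -> nat -> 'I_M.+1) (p : (nat -> 'I_2) -> R) (L : nat),
    (forall x, [/\ q < p x, p x < r, expansion_value (p x) (b x) = 1 &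
                   admissible (p x) (b x)]) /\
    (forall x y j, (forall i, (i < j)%N -> x i = y i) -> x j <> y j ->
       exists k, [/\ (k < L * j.+1)%N, (forall i, (i < k)%N -> b x i = b y i) &
                     b x k <> b y k]).
Proof.
move=> /univoque_base_expansion[q1 [a a1 ad]] qr rM.
have tails := admissible_tails_lt1 q1 (lt_trans qr rM) a1 ad.
have a_le1 n : expansion_value q (tail n.+1 a) <= 1 by apply: ltW (tails n).1.
have tail_lt n : lexlt (tail n.+1 a) a.
  by apply: (expansion_lt_lexlt q1) => //; rewrite a1; exact: (tails n).1.
have bar_lt n : lexlt (tail n.+1 (bar a)) a.
  by apply: (expansion_lt_lexlt q1) => //; rewrite a1; exact: (tails n).2.
have r1 : 1 < r by lra.
have gap : 0 < 1 - expansion_value r a.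
  by have := expansion_mono a q1 (ltW qr); rewrite a1; nra.
have [L HL] := ltr_exp_small (M%:R / (r - 1)) r1 gap.
have [N LN aN] := unbordered_exists tail_lt (ltn0Sn L).
have N1 : (1 < N)%N by exact: leq_ltn_trans LN.
pose b x := block_seq a (N := N) false (block_code x).
have bE x i : (i < N.-1)%N -> b x i = a i.
  move=> iN; apply/val_inj => /=; rewrite (block_seq0E bar_lt N1 aN)//; last by lia.
  by rewrite /block_digit (ltn_eqF iN) addn0.
have b_last x : (a N.-1 < b x N.-1)%N.
  by rewrite (block_seq0E bar_lt N1 aN) ?prednK//; [rewrite /block_digit eqxx addn1|lia].
have bq x : 1 < expansion_value q (b x).
  have := expansion_first_difference q1 (fun i iN => esym (bE x i iN)) (b_last x).
  have : 0 < (1 + expansion_value q (tail N.-1.+1 (b x)) -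
              expansion_value q (tail N.-1.+1 a)) / q ^+ N.-1.+1.
    rewrite divr_gt0 ?exprn_gt0//; last by lra.
    by have := expansion_ge0 (tail N.-1.+1 (b x)) q1; have := (tails N.-1).1; lra.
  by rewrite a1; lra.
have br x : expansion_value r (b x) < 1.
  have : expansion_value r (b x) - expansion_value r a <= M%:R / (r - 1) / r ^+ L.
    by apply: expansion_prefix_le => // i iL; apply: bE; lia.
  lra.
have /choice[p Hp] x := expansion_ivt q1 qr (bq x) (br x).
exists b, p, (5 * N)%N; split => [x|x y j xy ne].
  have [qp pr p1] := Hp x; split => //.
  apply: lexlt_admissible => //; [lra|lra|].
  by apply: (block_seq_shifts_lt bar_lt N1 aN) => // j; exact: block_code_dense.
have [cE cne] := block_code_diff xy ne.
have [eqb neb] := block_seq_diff bar_lt N1 aN false cE cne.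
exists ((4 + j.*2) * N + N.-1)%N; split => //; nia.
Qed.

Lemma base_separation q r : 1 < q -> q < r -> r < M.+1%:R ->
  exists2 c, 0 < c & forall p p' d d' k,
    q < p -> p < r -> q < p' -> p' < r ->
    expansion_value p d = 1 -> expansion_value p' d' = 1 ->
    admissible p d -> admissible p' d' ->
    (forall i, (i < k)%N -> d i = d' i) -> d k <> d' k ->
    c / M.+1%:R ^+ k.+1 <= `|p - p'|.
Proof.
move=> q1 qr rM.
have M0 : 0 < M%:R :> R by move: rM; rewrite -natr1; lra.
pose C : R := M%:R / (q - 1) ^+ 2.
have C0 : 0 < C by rewrite divr_gt0// exprn_gt0//; lra.
pose c := M%:R / (r - 1) - 1.
have c0 : 0 < c by rewrite subr_gt0 ltr_pdivlMr ?mul1r; move: rM; rewrite -natr1; lra.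
exists (c / C); first exact: divr_gt0.
have aux p p' d d' k :
    q < p -> p < r -> q < p' -> p' < r ->
    expansion_value p d = 1 -> expansion_value p' d' = 1 ->
    admissible p d -> admissible p' d' ->
    (forall i, (i < k)%N -> d i = d' i) -> (d k < d' k)%N ->
    c / C / M.+1%:R ^+ k.+1 <= `|p - p'|.
  move=> qp pr qp' p'r d1 d1' ad ad' dE dk.
  have p1 : 1 < p by lra.
  have p1' : 1 < p' by lra.
  have [t1 _] := admissible_tails_lt1 p1 (lt_trans pr rM) d1 ad k.
  have [_ t1'] := admissible_tails_lt1 p1' (lt_trans p'r rM) d1' ad' k.
  have pp' : p <= p'.
    rewrite leNgt; apply/negP => p'p.
    have := expansion_first_difference p1 dE dk; rewrite d1.
    have : 0 < (1 + expansion_value p (tail k.+1 d') - expansion_value p (tail k.+1 d)) / p ^+ k.+1.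
      rewrite divr_gt0 ?exprn_gt0//; last by lra.
      by have := expansion_ge0 (tail k.+1 d') p1; lra.
    have := expansion_le d' p1' (ltW p'p); rewrite d1'; lra.
  have lo : c <= 1 + expansion_value p' (tail k.+1 d') - expansion_value p' (tail k.+1 d).
    have := expansion_le (tail k.+1 d) p1 pp'.
    move: t1'; rewrite -bar_tail expansion_bar//.
    have : (M%:R / (r - 1) <= M%:R / (p' - 1)).
      by rewrite ler_pM2l// lef_pV2 ?posrE; lra.
    rewrite /c; lra.
  have := expansion_first_difference p1' dE dk; rewrite d1' => fd.
  have lip := expansion_lipschitz d p1 pp'; rewrite d1 in lip.
  have pC : M%:R / (p - 1) ^+ 2 * (p' - p) <= C * (p' - p).
    apply: ler_wpM2r; first by lra.
    rewrite /C ler_pM2l// lef_pV2 ?posrE ?exprn_gt0//; [|lra|lra].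
    by apply: lerXn2r; rewrite ?nnegrE; lra.
  have cM : c / M.+1%:R ^+ k.+1 <= c / p' ^+ k.+1.
    rewrite ler_pM2l// lef_pV2 ?posrE ?exprn_gt0//; last by lra.
    by apply: lerXn2r; rewrite ?nnegrE//; lra.
  have cp : c / p' ^+ k.+1 <=
    (1 + expansion_value p' (tail k.+1 d') - expansion_value p' (tail k.+1 d)) / p' ^+ k.+1.
    by apply: ler_wpM2r => //; rewrite invr_ge0 exprn_ge0//; lra.
  rewrite distrC ger0_norm ?subr_ge0// mulrAC ler_pdivrMr// [leRHS]mulrC.
  lra.
move=> p p' d d' k qp pr qp' p'r d1 d1' ad ad' dE /eqP.
rewrite -val_eqE neq_ltn => /orP[lt|lt]; first exact: (aux p p' d d').
by rewrite distrC; apply: (aux p' p d' d) => // i ik; rewrite dE.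
Qed.

Lemma value_separation q r : 1 < q -> q < r -> r < M.+1%:R ->
  exists2 c, 0 < c & forall p p' d d' k,
    q < p -> p < r -> q < p' -> p' < r ->
    expansion_value p d = 1 -> expansion_value p' d' = 1 ->
    admissible p d -> admissible p' d' ->
    (forall i, (i < k)%N -> d i = d' i) -> d k <> d' k ->
    c / M.+1%:R ^+ k.+1 <=
    `|expansion_value (M.+1%:R : R) (scons ord0 d) -
      expansion_value (M.+1%:R : R) (scons ord0 d')|.
Proof.
move=> q1 qr rM; pose B : R := M.+1%:R; have B1 : 1 < B by rewrite /B; lra.
pose c := (1 - r / B) / B.
have rB : r / B < 1 by rewrite ltr_pdivrMr ?mul1r//; lra.
exists c; first by apply: divr_gt0; [rewrite subr_gt0|apply: lt_trans B1].
have aux p d d' k : q < p -> p < r -> expansion_value p d = 1 -> admissible p d ->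
    (forall i, (i < k)%N -> d i = d' i) -> (d k < d' k)%N ->
    c / B ^+ k.+1 <= expansion_value B (scons ord0 d') - expansion_value B (scons ord0 d).
  move=> qp pr d1 ad dE dk; have p1 : 1 < p by lra.
  have [t1 _] := admissible_tails_lt1 p1 (lt_trans pr rM) d1 ad k.
  rewrite !(expansion_rec (scons _ _))// !tail1_scons /= !add0r -mulrBl.
  rewrite /c mulrAC; apply: ler_wpM2r; first by rewrite invr_ge0; lra.
  apply: le_trans (expansion_first_difference B1 dE dk).
  apply: ler_wpM2r; first by rewrite invr_ge0 exprn_ge0//; lra.
  have := expansion_ge0 (tail k.+1 d') B1.
  have : expansion_value B (tail k.+1 d) <= r / B.
    rewrite ler_pdivlMr; last by lra.
    have := @expansion_mono _ _ p B (tail k.+1 d) p1; rewrite mulrC => h.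
    have := h (ltW (lt_trans pr rM)); nra.
  by move: (r / B) => t; lra.
move=> p p' d d' k qp pr qp' p'r d1 d1' ad ad' dE /eqP.
rewrite -val_eqE neq_ltn => /orP[lt|lt].
  rewrite distrC; apply: le_trans (ler_norm _); exact: (aux p).
by apply: le_trans (ler_norm _); apply: (aux p') => // i ik; rewrite dE.
Qed.

Lemma hausdorff_dim_univoque_bases_gt0 q r : univoque_bases M q -> q < r ->
  r <= M.+1%:R -> (0 < hausdorff_dim (univoque_bases M `&` `]q, r[%classic))%E.
Proof.
move=> uq qr rM; have q1 := uq.1; pose r' := (q + r) / 2.
have qr' : q < r' by rewrite /r'; lra.
have r'r : r' < r by rewrite /r'; lra.
have r'M : r' < M.+1%:R by lra.
have [b [p [L [Hp Hd]]]] := cantor_family uq qr' r'M.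
have [c c0 Hc] := base_separation q1 qr' r'M.
have M1 : 1 < M.+1%:R :> R by lra.
have [K K0 HK] := geometric_rate L M1 c0.
apply: (hausdorff_dim_gt0 (g := p) K0) => [x|x y j xy ne].
  have [qp pr p1 ad] := Hp x; split; first by apply: admissible_base p1 ad; lra.
  by rewrite /= in_itv/= qp; lra.
have [k [kL bE bne]] := Hd x y j xy ne.
apply: le_trans (HK j k kL) _.
have [? ? ? ?] := Hp x; have [? ? ? ?] := Hp y.
exact: (Hc _ _ (b x) (b y)).
Qed.

Lemma hausdorff_dim_univoque_seqs_gt0 q r : univoque_bases M q -> q < r ->
  r <= M.+1%:R ->
  (0 < hausdorff_dim (expansion_value (M.+1%:R : R) @`
         (univoque_seqs M r `\` univoque_seqs M q)))%E.
Proof.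
move=> uq qr rM; have q1 := uq.1; pose r' := (q + r) / 2.
have qr' : q < r' by rewrite /r'; lra.
have r'r : r' < r by rewrite /r'; lra.
have r'M : r' < M.+1%:R by lra.
have [b [p [L [Hp Hd]]]] := cantor_family uq qr' r'M.
have [c c0 Hc] := value_separation q1 qr' r'M.
have M1 : 1 < M.+1%:R :> R by lra.
have [K K0 HK] := geometric_rate L M1 c0.
pose g x := expansion_value (M.+1%:R : R) (scons ord0 (b x)).
apply: (hausdorff_dim_gt0 (g := g) K0) => [x|x y j xy ne].
  have [qp pr p1 ad] := Hp x; exists (scons ord0 (b x)) => //.
  apply: (scons_univoque q1 _ _ qp _ p1 ad); [lra| |lra].
  by move: M1; rewrite ltr1n ltnS.
have [k [kL bE bne]] := Hd x y j xy ne.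
apply: le_trans (HK j k kL) _.
have [? ? ? ?] := Hp x; have [? ? ? ?] := Hp y.
exact: (Hc (p x) (p y) (b x) (b y)).
Qed.

Lemma univoque_bases_countable q r : (0 < M)%N -> 1 < q -> q <= M.+1%:R ->
  countable (univoque_seqs M r `\` univoque_seqs M q) ->
  countable (univoque_bases M `&` `]q, r[%classic : set R).
Proof.
move=> M0 q1 qM.
have /choice[f Hf] : forall p : R, exists d : nat -> 'I_M.+1,
    univoque_bases M p -> expansion_value p d = 1 /\ admissible p d.
  move=> p; have [/univoque_base_expansion[p1 [d d1 ad]]|np] := pselect (univoque_bases M p).
    by exists d.
  by exists (fun=> ord0) => /np.
move=> /countable_injP[h hinj]; apply/countable_injP.
have in_diff p : (univoque_bases M `&` `]q, r[%classic) p ->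
    (univoque_seqs M r `\` univoque_seqs M q) (scons ord0 (f p)).
  move=> [up]; rewrite /= in_itv/= => /andP[qp pr].
  by have [d1 ad] := Hf p up; exact: (scons_univoque q1 qM M0 qp pr d1 ad).
exists (fun p => h (scons ord0 (f p))) => p p'; rewrite !inE => Ap Ap' /hinj.
rewrite !inE => /(_ (in_diff _ Ap) (in_diff _ Ap')) /(congr1 (tail 1)).
rewrite !tail1_scons => fE.
have [d1 _] := Hf p Ap.1; have [d1' _] := Hf p' Ap'.1; rewrite fE in d1.
have [p1 _] := Ap.1; have [p1' _] := Ap'.1.
have [pp'|p'p|//] := ltgtP p p'.
  by have := expansion_mono (f p') p1 (ltW pp'); rewrite d1 d1'; lra.
by have := expansion_mono (f p') p1' (ltW p'p); rewrite d1 d1'; lra.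
Qed.

End Cantor_family.

Theorem theorem1p1 (R : realType) (M : nat) (hM : (1 <= M)%N)
    (q : R) (hq1 : 1 < q) (hqM : q <= M.+1%:R) :
  (univoque_bases M q <->
     (forall r : R, q < r -> r <= M.+1%:R ->
        (0 < hausdorff_dim
               (expansion_value (M.+1%:R : R) @`
                  (univoque_seqs M r `\` univoque_seqs M q)))%E))
  /\
  (univoque_bases M q <->
     (forall r : R, q < r -> r <= M.+1%:R ->
        (0 < hausdorff_dim (univoque_bases M `&` `]q, r[%classic))%E)).
Proof.
have not_univoque : ~ univoque_bases M q -> exists r, [/\ q < r, r <= M.+1%:R &
    countable (univoque_seqs M r `\` univoque_seqs M q)].
  move=> nu; have qltM : q < M.+1%:R.
    rewrite lt_neqAle hqM andbT; apply/eqP => qE; apply: nu.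
    by rewrite qE; exact: univoque_base_max.
  have [r /andP[qr rM] cr] := univoque_seqs_countable hq1 qltM nu.
  by exists r.
split; split=> [uq r|H].
- exact: hausdorff_dim_univoque_seqs_gt0.
- apply: contrapT => /not_univoque[r [qr rM cr]].
  have := H r qr rM; rewrite ltNge hausdorff_dim_countable//.
  by apply: sub_countable cr; exact: card_image_le.
- exact: hausdorff_dim_univoque_bases_gt0.
- apply: contrapT => /not_univoque[r [qr rM cr]].
  have := H r qr rM; rewrite ltNge hausdorff_dim_countable//.
  exact: univoque_bases_countable cr.
Qed.
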